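(* Let $(\Phi,\Psi)$ be a $\delta$-interleaving pair between persistence modules $V$ and $W$, where $0\le\delta<\frac12\min(\Xi(V),\Xi(W))$, and let $\chi_\Phi$ (from $\mathbf{Bar}(V)$ to $\mathbf{Bar}(W)$) and $\chi_\Psi$ (from $\mathbf{Bar}(W)$ to $\mathbf{Bar}(V)$) be the partial matchings induced by the ladder decompositions of $\Phi$ and $\Psi$. For any pair of bars $J_V\in\mathbf{Bar}(V)$ and $J_W\in\mathbf{Bar}(W)$ satisfying $|J_V|\ge2\delta$ and $|J_W|\ge 2\delta$, and any $\mu\in\mathbb{N}$, $$((J_V,J_W),\mu)\in\chi_\Phi\iff((J_W,J_V),\mu)\in\chi_\Psi .$$
   Context: Fix a field $\mathbb{F}$. A persistence module $V$ is a functor from $(\mathbb{R},\le)$ to $\mathbb{F}$-vector spaces, with inner morphisms $v_{s,t}\colon V_s\to V_t$ for $s\le t$, that is isomorphic to a finite direct sum of interval modules $k_J$, where $J=[i,j]$, $i\le j$, is a closed bounded interval and $k_J$ is $\mathbb{F}$ at indices in $J$, $0$ elsewhere, with identity inner morphisms inside $J$. The multiset of intervals in this decomposition is the barcode $\mathbf{Bar}(V)$; its elements are bars. The length of $J=[i,j]$ is $|J|=j-i$. A morphism $\Phi\colon V\to W$ is a family of linear maps $\Phi_t\colon V_t\to W_t$ commuting with inner morphisms. The shift $V(\delta)$ is given by $V(\delta)_t=V_{t+\delta}$, $v(\delta)_{s,t}=v_{s+\delta,t+\delta}$; for a bar $J=[i,j]$ put $J(\delta)=[i-\delta,j-\delta]$.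 A $\delta$-interleaving pair between $V$ and $W$ is a pair of morphisms $\Phi\colon V\to W(\delta)$, $\Psi\colon W\to V(\delta)$ with $\Psi_{t+\delta}\circ\Phi_t=v_{t,t+2\delta}$ and $\Phi_{t+\delta}\circ\Psi_t=w_{t,t+2\delta}$ for all $t$. Relations on intervals: $[i_1,j_1]\preceq[i_2,j_2]$ iff $i_1\le i_2\le j_1\le j_2$; $[i_1,j_1]\subset[i_2,j_2]$ (strictly nested) iff $i_2<i_1\le j_1<j_2$. Nestedness: $\Xi(V)=\min\{\min(|a-c|,|b-d|) : [a,b]\subset[c,d],\ [a,b],[c,d]\in\mathbf{Bar}(V)\}\in(0,\infty]$, equal to $\infty$ if there are no strictly nested bars. A ladder persistence module is a triple $(V,W,\Phi)$ with $\Phi\colon V\to W$ a morphism; isomorphisms are pairs of isomorphisms of the domains and codomains commuting with the morphisms; direct sums are componentwise. For $J_1\preceq J_2$, $\mathbf{R}_{J_1}^{J_2}=(k_{J_2},k_{J_1},\rho)$ with $\rho_t=\mathrm{id}$ for $t\in J_1\cap J_2$ and $0$ otherwise; $\mathbf{I}^+_J=(k_J,0,0)$; $\mathbf{I}^-_K=(0,k_K,0)$. A ladder decomposition of a morphism is an isomorphism of the corresponding triple with a finite direct sum of such elementary modules; its multiplicities are uniquely determined. Under the hypothesis $\delta<\frac12\min(\Xi(V),\Xi(W))$ ladder decompositions of $(V,W(\delta),\Phi)$ and $(W,V(\delta),\Psi)$ exist. The partial matching $\chi_\Phi$ induced by the ladder decomposition of $\Phi\colon V\to W(\delta)$ is the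 multiset of pairs in which $(J_V,J_W)\in\mathbf{Bar}(V)\times\mathbf{Bar}(W)$ has multiplicity equal to the multiplicity of $\mathbf{R}_{J_W(\delta)}^{J_V}$ in that decomposition; $((J_V,J_W),\mu)\in\chi_\Phi$ means this multiplicity is $\mu$. Likewise $\chi_\Psi$ contains $(J_W,J_V)$ with the multiplicity of $\mathbf{R}_{J_V(\delta)}^{J_W}$ in the ladder decomposition of $\Psi\colon W\to V(\delta)$. *)

(* Defs.v *)
From HB Require Import structures.
From mathcomp Require Import all_boot all_order all_algebra.
From mathcomp Require Import reals constructive_ereal.

Set Implicit Arguments.
Unset Strict Implicit.
Unset Printing Implicit Defensive.

Import Order.TTheory GRing.Theory Num.Theory.
Local Open Scope ring_scope.

(* A closed bounded interval [i, j] is encoded as a pair (i, j) with i <= j. *)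
Record bar (R : realType) :=
  Bar { bar_val :> R * R; bar_valP : bar_val.1 <= bar_val.2 }.

HB.instance Definition _ (R : realType) := [isSub for @bar_val R].
HB.instance Definition _ (R : realType) := [Choice of bar R by <:].

Definition lo (R : realType) (J : bar R) : R := (bar_val J).1.
Definition hi (R : realType) (J : bar R) : R := (bar_val J).2.

Definition in_bar (R : realType) (J : bar R) (t : R) : bool := lo J <= t <= hi J.

Definition bar_length (R : realType) (J : bar R) : R := hi J - lo J.

Lemma bar_shift_subproof (R : realType) (delta : R) (J : bar R) :
  lo J - delta <= hi J - delta.
Proof. by rewrite lerD2r; exact: bar_valP. Qed.

Definition bar_shift (R : realType) (delta : R) (J : bar R) : bar R :=
  @Bar R (lo J - delta, hi J - delta) (bar_shift_subproof delta J).

Definition bar_prec (R : realType) (J1 J2 : bar R) : bool :=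
  [&& lo J1 <= lo J2, lo J2 <= hi J1 & hi J1 <= hi J2].

Definition bar_nested (R : realType) (J K : bar R) : bool :=
  (lo K < lo J) && (hi J < hi K).

Definition nestedness (R : realType) (B : seq (bar R)) : \bar R :=
  \big[Order.min/+oo%E]_(p <- [seq (J, K) | J <- B, K <- B] | bar_nested p.1 p.2)
     (Num.min `|lo p.1 - lo p.2| `|hi p.1 - hi p.2|)%:E.

(* Functors from (R, <=) to F-vector spaces; the persistence modules in the
   sense used here are those admitting a finite barcode, see [is_barcode]. *)
Record pfunctor (R : realType) (F : fieldType) := PFunctor {
  pobj :> R -> lmodType F;
  pmap : forall s t : R, s <= t -> {linear pobj s -> pobj t};
  pmap_id : forall (t : R) (h : t <= t) (x : pobj t), pmap h x = x;
  pmap_comp : forall (s t u : R) (h : s <= t) (k : t <= u) (l : s <= u)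
    (x : pobj s), pmap l x = pmap k (pmap h x)
}.

Record phom (R : realType) (F : fieldType) (V W : pfunctor R F) := PHom {
  phom_fun :> forall t : R, {linear V t -> W t};
  phom_nat : forall (s t : R) (h : s <= t) (x : V s),
    phom_fun t (pmap V h x) = pmap W h (phom_fun s x)
}.

Definition is_piso (R : realType) (F : fieldType) (V W : pfunctor R F)
    (f : phom V W) : Prop :=
  exists g : phom W V,
    (forall t, cancel (f t) (g t)) /\ (forall t, cancel (g t) (f t)).

Definition piso (R : realType) (F : fieldType) (V W : pfunctor R F) : Prop :=
  exists f : phom V W, is_piso f.

Lemma shift_le (R : realType) (delta s t : R) : s <= t -> s + delta <= t + delta.
Proof. by rewrite lerD2r. Qed.

Definition pshift (R : realType) (F : fieldType) (delta : R)
    (V : pfunctor R F) : pfunctor R F :=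
  @PFunctor R F (fun t => V (t + delta))
    (fun s t (h : s <= t) => pmap V (shift_le delta h))
    (fun t h x => pmap_id (shift_le delta h) x)
    (fun s t u h k l x =>
       pmap_comp (shift_le delta h) (shift_le delta k) (shift_le delta l) x).

Lemma shift2_le (R : realType) (delta : R) (delta_ge0 : 0 <= delta) (t : R) :
  t <= t + delta + delta.
Proof. by rewrite -addrA lerDl addr_ge0. Qed.

(* The index t + 2 delta is written t + delta + delta, so that both sides of
   each equation live in the same vector space. *)
Definition interleaving_pair (R : realType) (F : fieldType) (V W : pfunctor R F)
    (delta : R) (delta_ge0 : 0 <= delta)
    (Phi : phom V (pshift delta W)) (Psi : phom W (pshift delta V)) : Prop :=
  (forall (t : R) (x : V t),
     Psi (t + delta) (Phi t x) = pmap V (shift2_le delta_ge0 t) x) /\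
  (forall (t : R) (y : W t),
     Phi (t + delta) (Psi t y) = pmap W (shift2_le delta_ge0 t) y).

Section IntervalModules.
Context (R : realType) (F : fieldType).
Implicit Types J K : bar R.

(* The value of k_J at t is F^d with d = (t \in J) : bool coerced to nat, that
   is F if t lies in J and 0 otherwise; multiplication by [pid_mx 1] is the
   identity of F when both dimensions are 1, and 0 when one of them is 0. *)
Definition kobj J (t : R) : lmodType F := 'rV[F]_(in_bar J t).

Definition kmap J K (s t : R) : {linear kobj J s -> kobj K t} :=
  @mulmxr F 1 (in_bar J s) (in_bar K t) (pid_mx 1).

Lemma kmap_id J (t : R) (h : t <= t) (x : kobj J t) : kmap J J t t x = x.
Proof.
rewrite /kmap /= -[RHS]mulmx1 -pid_mx_1; congr (_ *m _).
apply/matrixP => i j; rewrite !mxE.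
by case: (in_bar J t) i j => /= [i j|[]//]; rewrite !ord1.
Qed.

Lemma kmap_comp3 (J K L : bar R) (s t u : R) (x : kobj J s) :
  (in_bar J s -> in_bar L u -> in_bar K t) ->
  kmap J L s u x = kmap K L t u (kmap J K s t x).
Proof.
rewrite /kmap /= -mulmxA mul_pid_mx => h; congr (_ *m _).
apply/matrixP => i j; rewrite !mxE.
move: h i j; case: (in_bar J s) => /= [h i|_ []//].
by move: h; case: (in_bar L u) => [/(_ isT isT) ->|_ []].
Qed.

Lemma in_bar_convex J (s t u : R) : s <= t -> t <= u ->
  in_bar J s -> in_bar J u -> in_bar J t.
Proof.
move=> st tu /andP[js _] /andP[_ uj]; apply/andP; split.
  exact: le_trans js st.
exact: le_trans tu uj.
Qed.

Definition kmod J : pfunctor R F :=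
  @PFunctor R F (kobj J) (fun s t _ => kmap J J s t) (@kmap_id J)
    (fun s t u h k _ x => kmap_comp3 x (in_bar_convex h k)).

Lemma krho_nat J1 J2 (h12 : bar_prec J1 J2) (s t : R) (h : s <= t) (x : kmod J2 s) :
  kmap J2 J1 t t (pmap (kmod J2) h x) = pmap (kmod J1) h (kmap J2 J1 s s x).
Proof.
case/and3P: h12 => l12 _ h12; rewrite -kmap_comp3 -?kmap_comp3 //.
  move=> /andP[a _] /andP[_ b]; apply/andP; split.
    exact: le_trans l12 a.
  exact: le_trans h b.
move=> /andP[a _] /andP[_ b]; apply/andP; split.
  exact: le_trans a h.
exact: le_trans b h12.
Qed.

Definition krho J1 J2 (h12 : bar_prec J1 J2) : phom (kmod J2) (kmod J1) :=
  @PHom R F (kmod J2) (kmod J1) (fun t => kmap J2 J1 t t) (krho_nat h12).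

End IntervalModules.

Section DirectSums.
Context (R : realType) (F : fieldType).
Implicit Types V W : pfunctor R F.

Definition pzero : pfunctor R F :=
  @PFunctor R F (fun _ => 'rV[F]_0 : lmodType F) (fun s t _ => idfun)
    (fun t h x => erefl) (fun s t u h k l x => erefl).

Definition zero_fun (U U' : lmodType F) : {linear U -> U'} := \0.

Lemma phom0_nat V W (s t : R) (h : s <= t) (x : V s) :
  zero_fun (V t) (W t) (pmap V h x) = pmap W h (zero_fun (V s) (W s) x).
Proof. by rewrite /= linear0. Qed.

Definition phom0 V W : phom V W :=
  @PHom R F V W (fun t => zero_fun (V t) (W t)) (@phom0_nat V W).

Section PairMap.
Context (A B A' B' : lmodType F) (f : {linear A -> A'}) (g : {linear B -> B'}).

Definition pair_map (x : A * B) : A' * B' := (f x.1, g x.2).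

Lemma pair_map_is_linear : linear pair_map.
Proof. by move=> a x y; rewrite /pair_map /= !linearP. Qed.

HB.instance Definition _ :=
  GRing.isLinear.Build F (A * B)%type (A' * B')%type *:%R pair_map
    pair_map_is_linear.

Definition pair_lin : {linear (A * B)%type -> (A' * B')%type} := pair_map.

End PairMap.

Lemma pdsum_id V W (t : R) (h : t <= t) (x : V t * W t) :
  pair_lin (pmap V h) (pmap W h) x = x.
Proof. by case: x => x y; rewrite /= /pair_map !pmap_id. Qed.

Lemma pdsum_comp V W (s t u : R) (h : s <= t) (k : t <= u) (l : s <= u)
    (x : V s * W s) :
  pair_lin (pmap V l) (pmap W l) x =
  pair_lin (pmap V k) (pmap W k) (pair_lin (pmap V h) (pmap W h) x).
Proof. by rewrite /= /pair_map /= -!pmap_comp. Qed.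

Definition pdsum V W : pfunctor R F :=
  @PFunctor R F (fun t => (V t * W t)%type : lmodType F)
    (fun s t h => pair_lin (pmap V h) (pmap W h))
    (@pdsum_id V W) (@pdsum_comp V W).

Lemma phom_dsum_nat V W V' W' (f : phom V V') (g : phom W W')
    (s t : R) (h : s <= t) (x : pdsum V W s) :
  pair_lin (f t) (g t) (pmap (pdsum V W) h x) =
  pmap (pdsum V' W') h (pair_lin (f s) (g s) x).
Proof. by rewrite /= /pair_map /= !phom_nat. Qed.

Definition phom_dsum V W V' W' (f : phom V V') (g : phom W W') :
    phom (pdsum V W) (pdsum V' W') :=
  @PHom R F (pdsum V W) (pdsum V' W') (fun t => pair_lin (f t) (g t))
    (phom_dsum_nat f g).

End DirectSums.

(* B represents the multiset Bar(V); it is unique up to permutation. *)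
Definition is_barcode (R : realType) (F : fieldType) (V : pfunctor R F)
    (B : seq (bar R)) : Prop :=
  piso V (foldr (fun J M => pdsum (kmod F J) M) (pzero R F) B).

Record ladder (R : realType) (F : fieldType) := Ladder {
  ldom : pfunctor R F;
  lcod : pfunctor R F;
  lmap : phom ldom lcod
}.

Definition ladder_iso (R : realType) (F : fieldType) (L M : ladder R F) : Prop :=
  exists (f : phom (ldom L) (ldom M)) (g : phom (lcod L) (lcod M)),
    [/\ is_piso f, is_piso g &
        forall (t : R) (x : ldom L t), g t (lmap L t x) = lmap M t (f t x)].

Definition ladder_zero (R : realType) (F : fieldType) : ladder R F :=
  Ladder (phom0 (pzero R F) (pzero R F)).

Definition ladder_dsum (R : realType) (F : fieldType) (L M : ladder R F) :
    ladder R F :=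
  Ladder (phom_dsum (lmap L) (lmap M)).

(* [LR] stands for R_{J1}^{J2} (subscript J1, the codomain, comes first),
   [LIplus] for I^+_J and [LIminus] for I^-_K. *)
Inductive ladder_label (R : realType) :=
| LR (J1 J2 : bar R) of bar_prec J1 J2
| LIplus (J : bar R)
| LIminus (K : bar R).

Definition elementary_ladder (R : realType) (F : fieldType)
    (l : ladder_label R) : ladder R F :=
  match l with
  | LR _ _ h => Ladder (krho F h)
  | LIplus J => Ladder (phom0 (kmod F J) (pzero R F))
  | LIminus K => Ladder (phom0 (pzero R F) (kmod F K))
  end.

Definition is_ladder_decomposition (R : realType) (F : fieldType)
    (V W : pfunctor R F) (f : phom V W) (D : seq (ladder_label R)) : Prop :=
  ladder_iso (Ladder f)
    (foldr (fun l L => ladder_dsum (elementary_ladder F l) L)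
       (ladder_zero R F) D).

Definition is_LR (R : realType) (J1 J2 : bar R) (l : ladder_label R) : bool :=
  if l is LR K1 K2 _ then (K1 == J1) && (K2 == J2) else false.

(* For a ladder decomposition D of a morphism V -> W(delta), this says that the
   pair (JV, JW) of bars of V and W has multiplicity mu in the induced partial
   matching, i.e. that R_{JW(delta)}^{JV} occurs exactly mu times in D. *)
Definition in_matching (R : realType) (delta : R) (D : seq (ladder_label R))
    (p : bar R * bar R) (mu : nat) : Prop :=
  count (is_LR (bar_shift delta p.2) p.1) D = mu.

(* Main.v *)
(* By symmetry it suffices to compare multiplicities in one direction. The
   copies of R_{JW(delta)}^{JV} in Phi provide elements x_i of V born with JV,
   elements w_i of W born with JW such that Phi x_i = w_i, and coordinates dual
   to both. Since Psi Phi is the inner morphism of V and bars have length at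
   least 2 delta, Psi w_i and x_i agree at the death of JV. Since Phi Psi is the
   inner morphism of W, the coordinates of Psi y vanish there whenever y is born
   before JW, or lives at the birth of JW and vanishes at its death. In a
   ladder decomposition of Psi the matrix of coordinates of Psi w_i, which is
   the identity, thus only receives contributions from the copies of
   R_{JV(delta)}^{JW}, each of rank at most one. *)
From HB Require Import structures.
From mathcomp Require Import all_boot all_order all_algebra.
From mathcomp Require Import reals constructive_ereal.
From mathcomp Require Import lra.
Require Import Defs.

Set Implicit Arguments.
Unset Strict Implicit.
Unset Printing Implicit Defensive.

Import Order.TTheory GRing.Theory Num.Theory.
Local Open Scope ring_scope.

(** * Composites, projections and injections of persistence modules *)

Section Morphisms.
Context (R : realType) (F : fieldType).
Implicit Types V W U : pfunctor R F.

Lemma pmap_trans V (s t u : R) (h : s <= t) (k : t <= u) (l : s <= u)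
  (x : V s) : pmap V k (pmap V h x) = pmap V l x.
Proof. by rewrite -pmap_comp. Qed.

Lemma phom_comp_nat V W U (g : phom W U) (f : phom V W) (s t : R) (h : s <= t)
  (x : V s) : (g t \o f t) (pmap V h x) = pmap U h ((g s \o f s) x).
Proof. by rewrite /= !phom_nat. Qed.

Definition phom_comp V W U (g : phom W U) (f : phom V W) : phom V U :=
  @PHom R F V U (fun t => g t \o f t) (phom_comp_nat g f).

Definition phom_fst V W : phom (pdsum V W) V :=
  @PHom R F (pdsum V W) V (fun t => (fst : {linear (V t * W t)%type -> V t}))
    (fun s t h x => erefl).

Definition phom_snd V W : phom (pdsum V W) W :=
  @PHom R F (pdsum V W) W (fun t => (snd : {linear (V t * W t)%type -> W t}))
    (fun s t h x => erefl).

Section Injections.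
Context (A B : lmodType F).

Definition inl_fun (x : A) : A * B := (x, 0).
Definition inr_fun (y : B) : A * B := (0, y).

Lemma inl_fun_is_linear : linear inl_fun.
Proof. by move=> a x y; congr pair; rewrite /= scaler0 addr0. Qed.

Lemma inr_fun_is_linear : linear inr_fun.
Proof. by move=> a x y; congr pair; rewrite /= scaler0 addr0. Qed.

HB.instance Definition _ :=
  GRing.isLinear.Build F A (A * B)%type *:%R inl_fun inl_fun_is_linear.
HB.instance Definition _ :=
  GRing.isLinear.Build F B (A * B)%type *:%R inr_fun inr_fun_is_linear.

Definition inl_lin : {linear A -> (A * B)%type} := inl_fun.
Definition inr_lin : {linear B -> (A * B)%type} := inr_fun.

Lemma pair_split (x : A * B) : x = inl_lin x.1 + inr_lin x.2.
Proof. by case: x => x y; congr pair; rewrite /= ?addr0 ?add0r. Qed.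

End Injections.

Lemma phom_inl_nat V W (s t : R) (h : s <= t) (x : V s) :
  inl_lin (V t) (W t) (pmap V h x) = pmap (pdsum V W) h (inl_lin (V s) (W s) x).
Proof. by congr pair; rewrite /= linear0. Qed.

Lemma phom_inr_nat V W (s t : R) (h : s <= t) (x : W s) :
  inr_lin (V t) (W t) (pmap W h x) = pmap (pdsum V W) h (inr_lin (V s) (W s) x).
Proof. by congr pair; rewrite /= linear0. Qed.

Definition phom_inl V W : phom V (pdsum V W) :=
  @PHom R F V (pdsum V W) (fun t => inl_lin (V t) (W t)) (@phom_inl_nat V W).

Definition phom_inr V W : phom W (pdsum V W) :=
  @PHom R F W (pdsum V W) (fun t => inr_lin (V t) (W t)) (@phom_inr_nat V W).

End Morphisms.

(** * Maps between interval modules *)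

Section IntervalFacts.
Context (R : realType) (F : fieldType).
Implicit Types J K L : bar R.

Lemma kobj_out J (t : R) (x : kobj F J t) : in_bar J t = false -> x = 0.
Proof.
by rewrite /kobj in x *; case: (in_bar J t) x => // x _; apply: thinmx0.
Qed.

Lemma kmapK J K (s t : R) (x : kobj F J s) : in_bar K t ->
  kmap F K J t s (kmap F J K s t x) = x.
Proof. by move=> Kt; rewrite -kmap_comp3 ?kmap_id. Qed.

Lemma kmap_eq0 J K (s t : R) (x : kobj F J s) : in_bar K t ->
  kmap F J K s t x = 0 -> x = 0.
Proof. by move=> Kt e; rewrite -(kmapK x Kt) e linear0. Qed.

(** The generator 1 of F inside [J]; outside [J] it is the empty row, that is 0. *)
Definition kunit J (t : R) : kobj F J t := const_mx 1.

(** Since [kunit K t] is 0 outside [K], one equation covers both the survival and the death of a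
    generator. *)
Lemma kmap_unit J K (s t : R) : in_bar J s ->
  kmap F J K s t (kunit J s) = kunit K t.
Proof.
rewrite /kmap /kunit /=; case: (in_bar J s) => // _.
apply/rowP; case: (in_bar K t) => -[] // i lti.
rewrite !mxE big_ord1 !mxE /= mul1r.
by case: i lti.
Qed.

Lemma kunit_neq0 J (t : R) : in_bar J t -> kunit J t != 0.
Proof.
rewrite /kunit /kobj; case: (in_bar J t) => // _.
by apply/eqP => /rowP/(_ ord0)/eqP; rewrite !mxE oner_eq0.
Qed.

Lemma bar_eq J K : lo J = lo K -> hi J = hi K -> J = K.
Proof.
move=> e1 e2; apply/val_inj => /=.
by move: e1 e2; rewrite /lo /hi; case: (bar_val J) (bar_val K) => ? ? [? ?] /= -> ->.
Qed.

End IntervalFacts.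

(** * Split copies of one ladder inside another *)

Section Summands.
Context (R : realType) (F : fieldType).
Implicit Types L M E : ladder R F.

(* Pairwise independent split copies of E in L; the retractions of the codomain
   are only required to be compatible with those of the domain. *)
Definition summand_family L E (T : finType) : Prop :=
  exists (i1 : T -> phom (ldom E) (ldom L)) (i2 : T -> phom (lcod E) (lcod L))
         (p1 : T -> phom (ldom L) (ldom E)) (p2 : T -> phom (lcod L) (lcod E)),
    [/\ forall j t x, lmap L t (i1 j t x) = i2 j t (lmap E t x),
        forall j t x, lmap E t (p1 j t x) = p2 j t (lmap L t x) &
        forall i j t x, p1 i t (i1 j t x) = if i == j then x else 0].

Lemma summand_family_iso L M E (T : finType) :
  ladder_iso L M -> summand_family M E T -> summand_family L E T.
Proof.
case=> f [g [[f' [fK f'K]] [g' [gK g'K]] fg]] [i1 [i2 [p1 [p2 [ei ep pi]]]]].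
exists (fun j => phom_comp f' (i1 j)), (fun j => phom_comp g' (i2 j)),
  (fun j => phom_comp (p1 j) f), (fun j => phom_comp (p2 j) g).
split=> [j t x|j t x|i j t x] /=.
- by rewrite -ei -{2}(f'K t (i1 j t x)) -fg gK.
- by rewrite ep fg.
- by rewrite f'K pi.
Qed.

Lemma summand_family_dsumr L M E (T : finType) :
  summand_family M E T -> summand_family (ladder_dsum L M) E T.
Proof.
case=> i1 [i2 [p1 [p2 [ei ep pi]]]].
exists (fun j => phom_comp (phom_inr _ _) (i1 j)),
  (fun j => phom_comp (phom_inr _ _) (i2 j)),
  (fun j => phom_comp (p1 j) (phom_snd _ _)),
  (fun j => phom_comp (p2 j) (phom_snd _ _)).
split=> [j t x|j t x|i j t x] /=; rewrite ?ep ?pi //.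
by rewrite /pair_map /inr_fun /= linear0 ei.
Qed.

Lemma summand_family_dsuml M E (T : finType) :
  summand_family M E T -> summand_family (ladder_dsum E M) E (option T).
Proof.
case=> i1 [i2 [p1 [p2 [ei ep pi]]]].
exists (fun o => if o is Some j then phom_comp (phom_inr _ _) (i1 j)
                 else phom_inl _ _),
  (fun o => if o is Some j then phom_comp (phom_inr _ _) (i2 j)
            else phom_inl _ _),
  (fun o => if o is Some j then phom_comp (p1 j) (phom_snd _ _)
            else phom_fst _ _),
  (fun o => if o is Some j then phom_comp (p2 j) (phom_snd _ _)
            else phom_fst _ _).
split=> [[j|] t x|[j|] t x|[i|] [j|] t x] //=.
- by rewrite /pair_map /inr_fun /= linear0 ei.
- by rewrite /pair_map /inl_fun /= linear0.
- by rewrite ep.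
- by rewrite pi.
- by rewrite linear0.
Qed.

(** Each matching label adds one index, [None], for its own copy. The proof of precedence stored in
    a label is irrelevant because the relation is boolean. *)
Lemma summand_family_decomposition (D : seq (ladder_label R)) (J1 J2 : bar R)
    (h : bar_prec J1 J2) :
  exists2 T : finType, #|T| = count (is_LR J1 J2) D &
    summand_family (foldr (fun l L => ladder_dsum (elementary_ladder F l) L)
      (ladder_zero R F) D) (Ladder (krho F h)) T.
Proof.
elim: D => [|l D [T cT fT]] /=.
  exists void; first by rewrite card_void.
  by do 4!exists (fun v : void => match v with end); split=> -[].
case e: (is_LR J1 J2 l); last first.
  by exists T; [exact: cT | exact: summand_family_dsumr].
exists (option T); first by rewrite card_option cT.
case: l e => //= K1 K2 k /andP[/eqP e1 /eqP e2]; subst K1 K2.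
by rewrite (bool_irrelevance k h); exact: summand_family_dsuml.
Qed.

End Summands.

(** * Rank bounds read off a ladder decomposition *)

Section Probes.
Context (R : realType) (F : fieldType).
Implicit Types (L M : ladder R F) (J : bar R).

(* The conditions on [xi] force it to vanish on the contribution of every
   elementary ladder other than R_{J1}^{J2}. *)
Definition probe L J1 J2 (m : nat)
    (w : 'I_m -> ldom L (lo J2)) (x : 'I_m -> lcod L (lo J1))
    (xi : {linear lcod L (hi J1) -> 'rV[F]_m}) : Prop :=
  [/\ forall j u (h : lo J2 <= u), hi J2 < u -> pmap (ldom L) h (w j) = 0,
      forall j u (h : lo J1 <= u), hi J1 < u -> pmap (lcod L) h (x j) = 0,
      forall j (h : lo J2 <= hi J1) (k : lo J1 <= hi J1),
        lmap L (hi J1) (pmap (ldom L) h (w j)) = pmap (lcod L) k (x j),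
      forall t (h : t <= hi J1) (y : lcod L t),
        t < lo J1 -> xi (pmap (lcod L) h y) = 0 &
      (forall t (h : t <= hi J1) (y : ldom L t),
        t < lo J2 -> xi (lmap L (hi J1) (pmap (ldom L) h y)) = 0) /\
      (forall (h : lo J2 <= hi J1) (k : lo J2 <= hi J2) (y : ldom L (lo J2)),
        pmap (ldom L) k y = 0 -> xi (lmap L (hi J1) (pmap (ldom L) h y)) = 0)].

(** Such bounds are invariant under isomorphism and add up over direct sums, so elementary ladders
    suffice to establish them. *)
Definition probe_rank_le L J1 J2 (n : nat) : Prop :=
  forall m w x (xi : {linear lcod L (hi J1) -> 'rV[F]_m}), @probe L J1 J2 m w x xi ->
  (\rank (\matrix_j xi (pmap (lcod L) (bar_valP J1) (x j))) <= n)%N.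

(** Elements are pushed forward along [q1], [q2] and [xi] is pulled back along [i2]. This serves
    both isomorphisms and direct summands. *)
Lemma probe_transfer L M J1 J2 m w x xi
    (i1 : phom (ldom M) (ldom L)) (i2 : phom (lcod M) (lcod L))
    (q1 : phom (ldom L) (ldom M)) (q2 : phom (lcod L) (lcod M)) :
  (forall t y, lmap L t (i1 t y) = i2 t (lmap M t y)) ->
  (forall t y, lmap M t (q1 t y) = q2 t (lmap L t y)) ->
  @probe L J1 J2 m w x xi ->
  @probe M J1 J2 m (fun j => q1 _ (w j)) (fun j => q2 _ (x j)) (xi \o i2 (hi J1)).
Proof.
move=> ei eq [p1 p2 p3 p4 [p5 p6]].
split=> [j u h hu|j u h hu|j h k|t h y ty|]; last split=> [t h y ty|h k y ky] /=.
- by rewrite -phom_nat p1 // linear0.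
- by rewrite -phom_nat p2 // linear0.
- by rewrite -!phom_nat eq (p3 _ _ k).
- by rewrite /= phom_nat p4.
- by rewrite -ei phom_nat p5.
- by rewrite -ei phom_nat (p6 _ k) // -phom_nat ky linear0.
Qed.

Lemma probe_rank_le_iso L M J1 J2 n : ladder_iso L M ->
  probe_rank_le M J1 J2 n -> probe_rank_le L J1 J2 n.
Proof.
case=> f [g [[f' [fK f'K]] [g' [gK g'K]] fg]] le m w x xi p.
have fg' t y : lmap L t (f' t y) = g' t (lmap M t y).
  by rewrite -{2}(f'K t y) -fg gK.
have := le _ _ _ _ (probe_transfer fg' (fun t y => esym (fg t y)) p).
congr (\rank _ <= n)%N.
by apply/row_matrixP => j; rewrite !rowK /= -(phom_nat g) gK.
Qed.

(** The matrix of a probe is the sum of the matrices of its restrictions to the summands, and rank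
    is subadditive. *)
Lemma probe_rank_le_dsum L M J1 J2 n n' :
  probe_rank_le L J1 J2 n -> probe_rank_le M J1 J2 n' ->
  probe_rank_le (ladder_dsum L M) J1 J2 (n + n').
Proof.
move=> leL leM m w x xi p.
have hL := leL _ _ _ _ (@probe_transfer (ladder_dsum L M) L _ _ _ _ _ _
  (phom_inl _ _) (phom_inl _ _) (phom_fst _ _) (phom_fst _ _) _ _ p).
have hM := leM _ _ _ _ (@probe_transfer (ladder_dsum L M) M _ _ _ _ _ _
  (phom_inr _ _) (phom_inr _ _) (phom_snd _ _) (phom_snd _ _) _ _ p).
apply: leq_trans (leq_add (hL _ _) (hM _ _)) => //; first last.
- by move=> t y; congr pair; rewrite /= linear0.
- by move=> t y; congr pair; rewrite /= linear0.
apply: leq_trans (mxrank_add _ _); rewrite eq_leq //; congr (\rank _).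
apply/row_matrixP => j; rewrite linearD /= !rowK /= -linearD; congr (xi _).
exact: pair_split.
Qed.

Lemma probe_rank_le0 L J1 J2 (n : nat) :
  (forall m w x xi, @probe L J1 J2 m w x xi ->
     forall j, xi (pmap (lcod L) (bar_valP J1) (x j)) = 0) ->
  probe_rank_le L J1 J2 n.
Proof.
move=> L0 m w x xi p; rewrite (_ : \matrix_j _ = 0) ?mxrank0 //.
by apply/row_matrixP => j; rewrite rowK (L0 _ _ _ _ p) linear0.
Qed.

(** For the matching label the matrix factors through a space of dimension at most 1. For any other
    label, a nonzero row would keep [x j] and [w j] alive up to [hi J1], and the probe conditions
    would then force all endpoints to agree. *)
Lemma probe_rank_krho J1 J2 (h12 : bar_prec J1 J2) K1 K2 (k : bar_prec K1 K2) :
  probe_rank_le (Ladder (krho F k)) J1 J2 ((K1 == J1) && (K2 == J2)).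
Proof.
have := h12; case/and3P => l12 l21 hh.
case e: (_ && _).
  move=> m w x xi _; set A := \matrix_j _.
  pose B : 'M[F]_(m, _) := \matrix_j (pmap (kmod F K1) (bar_valP J1) (x j)).
  have -> : A = B *m lin1_mx xi.
    by apply/row_matrixP => j; rewrite row_mul /A /B !rowK mul_rV_lin1.
  apply: leq_trans (mxrankM_maxl _ _) _; apply: leq_trans (rank_leq_col _) _.
  exact: leq_b1.
apply: probe_rank_le0 => m w x xi [p1 p2 p3 p4 [p5 p6]] j.
apply/eqP/negPn/negP => nz.
have nzx u (h : lo J1 <= u) : u <= hi J1 -> pmap (kmod F K1) h (x j) != 0.
  move=> hu; apply: contra nz => /eqP x0.
  by rewrite -(pmap_trans h hu) x0 !linear0.
have nzw u (h : lo J2 <= u) : u <= hi J1 -> pmap (kmod F K2) h (w j) != 0.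
  move=> hu; apply: contra nz => /eqP w0.
  by rewrite -(p3 j l21 (bar_valP J1)) -(pmap_trans h hu) w0 !linear0.
have in1 u : lo J1 <= u <= hi J1 -> in_bar K1 u.
  case/andP=> h hu; apply/negPn/negP => /negbTE out.
  by case/eqP: (nzx u h hu); apply: kobj_out.
have in2 u : lo J2 <= u <= hi J1 -> in_bar K2 u.
  case/andP=> h hu; apply/negPn/negP => /negbTE out.
  by case/eqP: (nzw u h hu); apply: kobj_out.
have /andP[a1 _] := in1 _ (introT andP (conj (lexx _) (bar_valP J1))).
have /andP[_ b1] := in1 _ (introT andP (conj (bar_valP J1) (lexx _))).
have /andP[a2 _] := in2 _ (introT andP (conj (lexx _) l21)).
have /andP[_ b2] := in2 _ (introT andP (conj l21 (lexx _))).
have lK J : in_bar J (lo J) by rewrite /in_bar lexx; exact: bar_valP.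
have hK J : in_bar J (hi J) by rewrite /in_bar lexx andbT; exact: bar_valP.
(* If [K1] started earlier, [x j] would come from before [lo J1], where [xi] vanishes; if it ended
   later, [x j] would outlive [hi J1]. *)
have eK1 : K1 = J1.
  apply: bar_eq; apply/eqP; rewrite eq_le.
    rewrite a1 leNgt; apply/negP => lt.
    case/negP: nz; apply/eqP.
    have h : lo K1 <= hi J1 by apply: le_trans a1 (bar_valP J1).
    rewrite -(p4 _ h (kmap F K1 K1 _ _ (x j)) lt); congr (xi _).
    by apply: kmap_comp3.
  rewrite b1 andbT leNgt; apply/negP => lt.
  have h : lo J1 <= hi K1 by apply: le_trans (bar_valP J1) b1.
  have := p2 j _ h lt.
  move=> /(kmap_eq0 (hK K1)) x0.
  by move: nz; rewrite x0 !linear0 eqxx.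
have eK2 : K2 = J2.
  apply: bar_eq; apply/eqP; rewrite eq_le.
    rewrite a2 leNgt; apply/negP => lt.
    case/negP: nz; apply/eqP.
    have h : lo K2 <= hi J1 by apply: le_trans a2 l21.
    rewrite -(p5 _ h (kmap F K2 K2 _ _ (w j)) lt); congr (xi _).
    rewrite -(p3 j l21); congr (kmap F K2 K1 _ _ _).
    by apply: kmap_comp3.
  apply/andP; split; rewrite leNgt; apply/negP => lt.
    have h : lo J2 <= hi K2 by apply: le_trans l21 b2.
    move/(kmap_eq0 (hK K2)): (p1 j _ h lt) => w0.
    by move: nz; rewrite -(p3 j l21) w0 !linear0 eqxx.
  (* Here [K2] ends before [hi J2], so [w j] is dead at [hi J2] and the last probe condition
     applies. *)
  case/negP: nz; apply/eqP; rewrite -(p3 j l21).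
  by apply: p6 => //; [exact: bar_valP|move=> ?; apply: kobj_out; rewrite /in_bar (lt_geF lt) andbF].
by rewrite eK1 eK2 !eqxx in e.
Qed.

(** I^+ has zero codomain. I^- has zero ladder map, so [x j], being the image of [w j] at [hi J1],
    vanishes there. *)
Lemma probe_rank_decomposition (D : seq (ladder_label R)) J1 J2 :
  bar_prec J1 J2 ->
  probe_rank_le (foldr (fun l L => ladder_dsum (elementary_ladder F l) L)
      (ladder_zero R F) D) J1 J2 (count (is_LR J1 J2) D).
Proof.
move=> h; elim: D => [|l D IH] /=.
  apply: probe_rank_le0 => m w x xi _ j.
  by rewrite (_ : pmap _ _ _ = 0) ?linear0 //; exact: thinmx0.
apply: probe_rank_le_dsum IH; case: l => [K1 K2 k|K|K].
- exact: probe_rank_krho.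
- apply: probe_rank_le0 => m w x xi _ j.
  by rewrite (_ : pmap _ _ _ = 0) ?linear0 //; exact: thinmx0.
- apply: probe_rank_le0 => m w x xi [_ _ p3 _ _] j.
  have /and3P[_ l21 _] := h.
  by rewrite -(p3 j l21) linear0.
Qed.

End Probes.

(** * Comparison of the two matchings *)

Section Matching.
Context (R : realType) (F : fieldType).

Section Coordinates.
Context (U : lmodType F) (T : finType) (n : nat) (p : T -> {linear U -> 'rV[F]_n}).

(** In use, [n] is a boolean dimension: multiplying by the all-ones column gives the sole coordinate
    if [n] is 1 and 0 if [n] is 0. *)
Definition coords_fun (y : U) : 'rV[F]_#|T| :=
  \row_k (p (enum_val k) y *m (const_mx 1 : 'cV_n)) 0 0.

Lemma coords_fun_is_linear : linear coords_fun.
Proof.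
by move=> a y z; apply/rowP => k; rewrite [LHS]mxE linearP mulmxDl -scalemxAl !mxE.
Qed.

HB.instance Definition _ :=
  GRing.isLinear.Build F U 'rV[F]_#|T| *:%R coords_fun coords_fun_is_linear.

Definition coords : {linear U -> 'rV[F]_#|T|} := coords_fun.

Lemma coords_eq0 y : (forall j, p j y = 0) -> coords y = 0.
Proof. by move=> p0; apply/rowP => k; rewrite [LHS]mxE p0 mul0mx !mxE. Qed.

End Coordinates.

Lemma coords_delta (U : lmodType F) (T : finType) (J : bar R) (t : R)
    (p : T -> {linear U -> kobj F J t}) (y : U) (k : 'I_#|T|) :
  in_bar J t ->
  (forall j, p j y = if j == enum_val k then kunit F J t else 0) ->
  coords p y = delta_mx 0 k.
Proof.
move=> Jt py; apply/rowP => i; rewrite [LHS]mxE [RHS]mxE py (inj_eq enum_val_inj) /=.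
case: eqP => _; last by rewrite mul0mx mxE.
rewrite /kunit; move: Jt; rewrite /kobj; case: (in_bar J t) => // _.
by rewrite !mxE big_ord1 !mxE mulr1.
Qed.

Lemma count_is_LR_prec (D : seq (ladder_label R)) (J1 J2 : bar R) :
  (0 < count (is_LR J1 J2) D)%N -> bar_prec J1 J2.
Proof.
elim: D => // -[K1 K2 k|K|K] D IH //=.
by case: andP => [[/eqP <- /eqP <-]|_].
Qed.

Lemma count_is_LR_le (V W : pfunctor R F) (delta : R) (delta_ge0 : 0 <= delta)
    (Phi : phom V (pshift delta W)) (Psi : phom W (pshift delta V))
    (DPhi DPsi : seq (ladder_label R)) (JV JW : bar R) :
  interleaving_pair delta_ge0 Phi Psi ->
  is_ladder_decomposition Phi DPhi -> is_ladder_decomposition Psi DPsi ->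
  2 * delta <= bar_length JV -> 2 * delta <= bar_length JW ->
  (count (is_LR (bar_shift delta JW) JV) DPhi <=
   count (is_LR (bar_shift delta JV) JW) DPsi)%N.
Proof.
move=> [PsiPhi PhiPsi] decPhi decPsi lV lW; rewrite /bar_length in lV lW.
have [->//|] := posnP (count (is_LR (bar_shift delta JW) JV) DPhi).
move=> /count_is_LR_prec h.
have [T <- fam] := summand_family_decomposition F DPhi h.
have {fam} := summand_family_iso decPhi fam.
case=> /= i1 [i2 [p1 [p2 [ei' ep' pi]]]].
have {ei'} ei j t y : Phi t (i1 j t y) = i2 j t (kmap F JV _ t t y) := ei' j t y.
have {ep'} ep j t y : kmap F JV _ t t (p1 j t y) = p2 j t (Phi t y) := ep' j t y.
have [->//|] := posnP #|T|; case/card_gt0P => i _.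
pose a := lo JV; pose b := hi JV; pose c := lo JW; pose d := hi JW.
have /and3P[] := h; rewrite /lo /hi /= -/(lo JW) -/(hi JW) -/(lo JV) -/(hi JV).
rewrite -/a -/b -/c -/d => ca ad db.
rewrite -/a -/b -/c -/d in lV lW.
have Kin t : in_bar (bar_shift delta JW) t = (c - delta <= t <= d - delta) by [].
have Jin t : in_bar JV t = (a <= t <= b) by [].
pose x j : V a := i1 j a (kunit F JV a).
(* The index [c - delta + delta] equals c but is not convertible to it; [lc] and [la] below
   transport along such equalities by inner morphisms. *)
pose w j : W (c - delta + delta) := i2 j (c - delta) (kunit F _ (c - delta)).
have x_at j t (k : a <= t) : pmap V k (x j) = i1 j t (kunit F JV t).
  by rewrite /x -phom_nat; congr (i1 j t _); apply: kmap_unit; rewrite Jin; lra.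
have w_at j (t : R) (k : c - delta <= t) :
    pmap (pshift delta W) k (w j) = i2 j t (kunit F _ t).
  by rewrite /w -phom_nat; congr (i2 j t _); apply: kmap_unit; rewrite Kin; lra.
have Phix j t (k : a <= t) (l : c - delta <= t) : t <= b ->
    Phi t (pmap V k (x j)) = pmap (pshift delta W) l (w j).
  move=> tb; rewrite x_at w_at ei; congr (i2 j t _).
  by apply: kmap_unit; rewrite Jin k.
have coord0 j t u (k : t <= u) (y : V t) : t < a -> p1 j u (pmap V k y) = 0.
  move=> ta; rewrite phom_nat (kobj_out (p1 j t y)) ?linear0 //.
  by rewrite Jin leNgt ta.
have coord_x j k t (l : a <= t) :
    p1 j t (pmap V l (x k)) = if j == k then kunit F JV t else 0.
  by rewrite x_at pi.
(* Otherwise Psi (Phi x_i) would be born before JV. *)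
have ac : a <= c + delta.
  rewrite leNgt; apply/negP => lt.
  have l2 : a <= a + delta + delta by lra.
  have inJ : in_bar JV (a + delta + delta) by rewrite Jin; lra.
  case/eqP: (kunit_neq0 F inJ).
  have := coord_x i i _ l2; rewrite eqxx => <-.
  rewrite (bool_irrelevance l2 (shift2_le delta_ge0 a)) -PsiPhi.
  rewrite -[x i](pmap_id (lexx a)) (Phix i a (lexx a) ca); last by lra.
  by rewrite phom_nat; apply: coord0; lra.
(* Otherwise Phi x_i would vanish at b - 2 delta, so x_i = Psi (Phi x_i) would vanish at b. *)
have bd : b <= d + delta.
  rewrite leNgt; apply/negP => lt.
  pose t := b - delta - delta.
  have l : a <= t by rewrite /t; lra.
  have l2 : a <= t + delta + delta by rewrite /t; lra.
  have inJ : in_bar JV (t + delta + delta) by rewrite Jin /t; lra.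
  case/eqP: (kunit_neq0 F inJ).
  have := coord_x i i _ l2; rewrite eqxx => <-.
  rewrite -(pmap_trans l (shift2_le delta_ge0 t)) -PsiPhi x_at ei.
  rewrite (kobj_out (kmap _ _ _ _ _ _)) ?linear0 // Kin; apply/negP => /andP[_].
  by rewrite /t; lra.
(* The middle inequality is c <= a + delta <= b - delta, by the length of [JV]. *)
have h' : bar_prec (bar_shift delta JV) JW.
  rewrite /bar_prec /lo /hi /= -/(lo JW) -/(hi JW) -/(lo JV) -/(hi JV).
  by rewrite -/a -/b -/c -/d; lra.
have le := probe_rank_le_iso decPsi (@probe_rank_decomposition R F DPsi _ _ h').
have lc : c - delta + delta <= c by lra.
have la : a <= a - delta + delta by lra.
pose w' (k : 'I_#|T|) : W c := pmap W lc (w (enum_val k)).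
pose x' (k : 'I_#|T|) : V (a - delta + delta) := pmap V la (x (enum_val k)).
pose xi : {linear V (b - delta + delta) -> 'rV[F]_#|T|} :=
  coords (fun j => p1 j (b - delta + delta)).
have w_at' j u (l : c - delta + delta <= u) (k : u - delta + delta <= u) :
    pmap W l (w j) = pmap W k (i2 j (u - delta) (kunit F _ (u - delta))).
  by rewrite -w_at; [lra|move=> e; rewrite (pmap_trans _ k l)].
(* The copies commute with Phi, so the [p1] coordinates of Psi y map to the [p2] coordinates of Phi
   (Psi y), that is, of y moved by 2 delta. This map is injective at [c + delta], which lies in the
   shifted [JW] because [JW] has length at least 2 delta. *)
have key (y : W c) (l : c <= c + delta + delta) (k : c <= b - delta) :
    (forall j, p2 j (c + delta) (pmap W l y) = 0) ->
    xi (Psi (b - delta) (pmap W k y)) = 0.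
  move=> y0; apply: coords_eq0 => j.
  rewrite (phom_nat Psi) (phom_nat (p1 j)).
  rewrite (_ : p1 j _ _ = 0) ?linear0 //.
  have inK : in_bar (bar_shift delta JW) (c + delta) by rewrite Kin; lra.
  apply: (kmap_eq0 inK); rewrite ep PhiPsi -(y0 j).
  by congr (p2 j _ (pmap W _ _)); exact: bool_irrelevance.
have prb : @probe R F (Ladder Psi) (bar_shift delta JV) JW _ w' x' xi.
  split=> [j u k uk|j u k uk|j k l|t k y tl|]; last split=> [t k y tl|k l y y0] /=.
  - have e : u - delta + delta <= u by lra.
    have l : c - delta + delta <= u by apply: le_trans lc k.
    rewrite (pmap_trans lc k l) (w_at' _ _ _ e) (kobj_out (kunit _ _ _)) ?linear0 //.
    by rewrite Kin; apply/negP => /andP[_]; rewrite -/d in uk; lra.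
  - have l : a <= u + delta by rewrite /lo /= -/(lo JV) -/a in k; lra.
    rewrite (pmap_trans la _ l) x_at (kobj_out (kunit _ _ _)) ?linear0 //.
    rewrite Jin; apply/negP => /andP[_].
    by rewrite /hi /= -/(hi JV) -/b in uk; lra.
  (* At b - 2 delta, still in [JV], Phi x is w; applying Psi gives x at b. *)
  - pose t := b - delta - delta.
    have e : a <= t by rewrite /t; lra.
    have e' : t + delta <= b - delta by rewrite /t; lra.
    have e2 : c - delta <= t by lra.
    have e3 : c - delta + delta <= b - delta by rewrite /t; lra.
    have e4 : t <= b by rewrite /t; lra.
    rewrite (pmap_trans lc k e3) -(pmap_trans (shift_le delta e2) e' e3).
    have := Phix (enum_val j) t e e2 e4; rewrite /= => <-.
    rewrite (phom_nat Psi) /= PsiPhi.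
    have e5 : a <= t + delta + delta by rewrite /t; lra.
    have e6 : a <= b - delta + delta by lra.
    rewrite (pmap_trans e _ e5) (pmap_trans e5 _ e6).
    by rewrite (pmap_trans la _ e6).
  - apply: coords_eq0 => j; apply: coord0.
    by rewrite /lo /= -/(lo JV) -/a in tl; lra.
  (* By [key]: the [p2] coordinates of y are already 0 at birth, before the shifted [JW] starts. *)
  - have tc : t <= c := ltW tl.
    have cb : c <= b - delta by lra.
    rewrite -(pmap_trans tc cb); have l : c <= c + delta + delta by lra.
    apply: (key _ l) => j.
    have e : t <= t - delta + delta by lra.
    have e' : t - delta <= c + delta by lra.
    have e2 : t <= c + delta + delta by lra.
    rewrite (pmap_trans tc l e2) -(pmap_trans e (shift_le delta e') e2).
    rewrite (phom_nat (p2 j) e') (kobj_out (p2 j _ _)) ?linear0 //.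
    by rewrite Kin; apply/negP => /andP[+ _]; rewrite -/c in tl; lra.
  (* By [key]: a [p2] coordinate survives from [c + delta] to [d - delta], where y has become 0. *)
  - have e : c <= c + delta + delta by lra.
    apply: (key _ e) => j.
    have inK : in_bar (bar_shift delta JW) (d - delta) by rewrite Kin; lra.
    apply: (kmap_eq0 inK).
    have e' : c + delta <= d - delta by lra.
    have := phom_nat (p2 j) e' (pmap W e y); rewrite /= => <-.
    have e2 : c <= d - delta + delta by lra.
    have e3 : d <= d - delta + delta by lra.
    by rewrite (pmap_trans e _ e2) -(pmap_trans l e3) y0 !linear0.
(* At b the coordinates of the x' form the identity matrix, of rank [#|T|]. *)
have := le _ _ _ _ prb; congr (_ <= _)%N.
rewrite -[RHS](mxrank1 F); congr (\rank _); apply/row_matrixP => k.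
rewrite rowK row1 /=; have l : a <= b - delta + delta by lra.
rewrite (pmap_trans la _ l); apply: coords_delta => [|j]; first by rewrite Jin; lra.
exact: coord_x.
Qed.

End Matching.

Theorem corollary5p3 (R : realType) (F : fieldType) (V W : pfunctor R F)
    (BV BW : seq (bar R))
    (barV : is_barcode V BV) (barW : is_barcode W BW)
    (delta : R) (delta_ge0 : 0 <= delta)
    (delta_lt : (delta%:E < (2^-1)%:E * Order.min (nestedness BV) (nestedness BW))%E)
    (Phi : phom V (pshift delta W)) (Psi : phom W (pshift delta V))
    (interleaved : interleaving_pair delta_ge0 Phi Psi)
    (DPhi DPsi : seq (ladder_label R))
    (decPhi : is_ladder_decomposition Phi DPhi)
    (decPsi : is_ladder_decomposition Psi DPsi)
    (JV JW : bar R) (JV_in : JV \in BV) (JW_in : JW \in BW)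
    (JV_long : 2 * delta <= bar_length JV)
    (JW_long : 2 * delta <= bar_length JW)
    (mu : nat) :
  in_matching delta DPhi (JV, JW) mu <-> in_matching delta DPsi (JW, JV) mu.
Proof.
rewrite /in_matching /=.
suff -> : count (is_LR (bar_shift delta JW) JV) DPhi =
          count (is_LR (bar_shift delta JV) JW) DPsi by [].
apply/eqP; rewrite eqn_leq.
rewrite (count_is_LR_le interleaved) // (@count_is_LR_le _ _ _ _ _ delta_ge0 Psi Phi) //.
by case: interleaved.
Qed.
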